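(* Let $G=(V,E)$ be a finite connected graph with positive edge resistances $\ell^{(0)}$, and let $\ell(t)$, $t\in[0,T)$, be the solution of the Ricci--Foster flow \[\frac{d}{dt}\ell_e(t) = -K_e(\ell(t)), \qquad \ell_e(0)=\ell^{(0)}_e \qquad (e\in E).\] If $K_e(\ell^{(0)})\ge 0$ for every edge $e$, then $K_e(\ell(t))\ge 0$ for every edge $e$ and every $t\in[0,T)$.
   Context: An edge-weighted graph $(G,\ell)$ assigns to each edge $e$ a resistance $\ell_e>0$. For vertices $x,y$, the effective resistance is $\omega_{xy}=\tau(G/xy;\ell)/\tau(G;\ell)$, where $G/xy$ is obtained by identifying $x$ and $y$, and $\tau(H;\ell)=\sum_{T}\prod_{e\notin T}\ell_e$ over spanning trees $T$ of $H$. For an edge $e=uv$, the Ricci--Foster curvature is $K_e(\ell)=\frac{1}{\deg_u}+\frac{1}{\deg_v}-\frac{\omega_{uv}}{\ell_e}$, with $\deg_u$ the number of edges incident to $u$. *)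

(* Defs.v *)
From HB Require Import structures.
From mathcomp Require Import all_boot all_order all_algebra.
From mathcomp Require Import all_classical all_reals all_analysis.

Set Implicit Arguments.
Unset Strict Implicit.
Unset Printing Implicit Defensive.

Import Order.TTheory GRing.Theory Num.Theory.
Import numFieldNormedType.Exports.

Local Open Scope ring_scope.

(* Finite multigraphs: the edge set is the whole of E; parallel edges and loops
   are allowed, since both are created by identifying two vertices. The
   orientation given by (src, tgt) plays no role. The vertex set is a subset of
   V, so that identifying vertices does not change the carrier type. *)
Record mgraph (V E : finType) := MGraph {
  vset : {set V};
  src : E -> V;
  tgt : E -> V;
  src_in : forall e, src e \in vset;
  tgt_in : forall e, tgt e \in vset }.

Section Graph.
Variables V E : finType.
Implicit Types (G : mgraph V E) (F : {set E}) (x y u v : V) (e : E).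

Definition joins G e u v : bool :=
  ((src G e == u) && (tgt G e == v)) || ((src G e == v) && (tgt G e == u)).

Definition loopless G : Prop := forall e, src G e != tgt G e.

Definition adj G F u v : bool := [exists e in F, joins G e u v].

Definition spanning_connected G F : bool :=
  (0 < #|vset G|)%N &&
  [forall u in vset G, forall v in vset G, connect (adj G F) u v].

Definition connected_graph G : bool := spanning_connected G [set: E].

(* s = [:: (v_1, e_1); ...; (v_k, e_k)] with k >= 1, the v_i distinct, the e_i
   distinct elements of F, and e_i joining v_i to v_(i+1), indices modulo k;
   k = 1 is a loop and k = 2 a pair of parallel edges. *)
Definition is_cycle G F (s : seq (V * E)) : bool :=
  [&& s != [::], uniq (unzip1 s), uniq (unzip2 s),
      all (fun e => e \in F) (unzip2 s)
    & cycle (fun p q : V * E => joins G p.2 p.1 q.1) s].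

Definition acyclic G F : Prop := forall s, ~~ is_cycle G F s.

Definition spanning_tree G F : bool :=
  spanning_connected G F && `[< acyclic G F >].

Definition identify x y v : V := if v == y then x else v.

(* G/xy: all edges are kept, so the edges joining x and y become loops. *)
Definition contract G x y : mgraph V E :=
  @MGraph V E (identify x y @: vset G)
    (fun e => identify x y (src G e)) (fun e => identify x y (tgt G e))
    (fun e => imset_f _ (src_in G e)) (fun e => imset_f _ (tgt_in G e)).

Definition degree G u : nat := #|[pred e | (src G e == u) || (tgt G e == u)]|.

Variable R : realType.
Implicit Types (l : E -> R) (T : \bar R).

Definition tau G l : R :=
  \sum_(F : {set E} | spanning_tree G F) \prod_(e | e \notin F) l e.

(* Meaningful for x != y only. *)
Definition eff_resistance G l x y : R := tau (contract G x y) l / tau G l.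

Definition curvature G l e : R :=
  (degree G (src G e))%:R^-1 + (degree G (tgt G e))%:R^-1
  - eff_resistance G l (src G e) (tgt G e) / l e.

(* The derivative is taken relative to [0, T), hence one-sided at 0. Positivity
   of the resistances is the domain of definition of the curvature. *)
Definition flow_solution G (l0 : E -> R) T (l : R -> E -> R) : Prop :=
  [/\ forall e, l 0 e = l0 e,
      forall (t : R) e, 0 <= t -> (t%:E < T)%E -> 0 < l t e
    & forall (t : R) e, 0 <= t -> (t%:E < T)%E ->
      ((fun s : R => (l s e - l t e) / (s - t))
         @ within [set s : R | 0 <= s /\ (s%:E < T)%E] (dnbhs t)
       --> - curvature G (l t) e)%classic].

End Graph.

(* Main.v *)
(* Let [p_e = omega_e / l_e] be the probability that the weighted random spanning
   tree contains [e], so that [K_e = 1/deg u + 1/deg v - p_e].  Along the flow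
   [K_e' = sum_g A_eg K_g] with
   [A_eg = (P(e in T) P(g in T) - P(e, g in T)) / l_g], and negative correlation
   of the edges makes the off-diagonal coefficients nonnegative, so the
   nonnegative orthant is invariant.

   Negative correlation: for the current [I(l)], the signed count of the trees
   whose path between the ends of [e] crosses a given edge, [l_h I_h(l)] is the
   gradient of a potential (Kirchhoff), whence
   [sum_h l_h I_h(l) I_h(l') = tau(l') l_e N_e(l)] for any two resistances [l] and
   [l'], where [N_e] is the weighted number of trees through [e].  Exchanging the
   roles of [l] and [l'] when they differ only at [g] yields Rayleigh
   monotonicity. *)
Require Import Defs.
From mathcomp Require Import all_boot all_order all_algebra.
From mathcomp Require Import all_classical all_reals all_analysis.
From mathcomp Require Import ring lra.

Set Implicit Arguments.
Unset Strict Implicit.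
Unset Printing Implicit Defensive.

Import Order.TTheory GRing.Theory Num.Theory.
Import numFieldNormedType.Exports.

Local Open Scope ring_scope.

Lemma connect_closed_ind (T : finType) (r : rel T) (P : T -> Prop) (a b : T) :
  P a -> (forall x y, P x -> r x y -> P y) -> connect r a b -> P b.
Proof.
move=> Pa stepP /connectP[p pP ->]; elim: p a Pa pP => //= y p IHp a Pa.
by case/andP=> /(stepP _ _ Pa) Py /(IHp _ Py).
Qed.

(** * Linking by edge sets, and acyclicity *)

Section Connectivity.
Variables (V E : finType) (G : mgraph V E).
Implicit Types (F T : {set E}) (a b x y : V) (e h : E).

Lemma joinsC h a b : joins G h a b = joins G h b a.
Proof. by rewrite /joins orbC. Qed.

Lemma joins_ends h : joins G h (src G h) (tgt G h).
Proof. by rewrite /joins !eqxx. Qed.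

Lemma joinsE h a b : joins G h a b ->
  (a = src G h /\ b = tgt G h) \/ (a = tgt G h /\ b = src G h).
Proof. by case/orP=> /andP[/eqP <- /eqP <-]; [left|right]. Qed.

Definition linked F := connect (adj G F).

Lemma linkedC F a b : linked F a b = linked F b a.
Proof.
rewrite /linked; apply: sym_connect_sym => x y.
by apply: eq_existsb => h; rewrite joinsC.
Qed.

Lemma linked0 F a : linked F a a. Proof. exact: connect0. Qed.

Lemma linked_trans F b a c : linked F a b -> linked F b c -> linked F a c.
Proof. exact: connect_trans. Qed.

Lemma linked_eqr F a b c : linked F b c -> linked F a b = linked F a c.
Proof.
move=> bc; apply/idP/idP=> [ab|ac]; first exact: linked_trans ab bc.
by apply: linked_trans ac _; rewrite linkedC.
Qed.

Lemma linked_eql F a b c : linked F b c -> linked F b a = linked F c a.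
Proof. by move=> bc; rewrite ![linked F _ a]linkedC (linked_eqr _ bc). Qed.

Lemma adj_edge F h a b : h \in F -> joins G h a b -> adj G F a b.
Proof. by move=> hF hab; apply/existsP; exists h; rewrite hF. Qed.

Lemma linked_joins F h a b : h \in F -> joins G h a b -> linked F a b.
Proof. by move=> hF hab; apply/connect1/(adj_edge hF hab). Qed.

Lemma linked_edge F h : h \in F -> linked F (src G h) (tgt G h).
Proof. by move=> hF; apply: linked_joins hF (joins_ends h). Qed.

Lemma linked_sub F F' a b : F \subset F' -> linked F a b -> linked F' a b.
Proof.
move=> sFF'; apply: connect_sub => x y /existsP[h /andP[hF hxy]].
by apply: linked_joins hxy; apply: (fintype.subsetP sFF').
Qed.

Lemma linked_ends F h a b :
  joins G h a b -> linked F a b = linked F (src G h) (tgt G h).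
Proof. by case/joinsE=> [[-> ->]|[-> ->]] //; rewrite linkedC. Qed.

Lemma linkedU1 F h a b : linked (h |: F) a b ->
  [\/ linked F a b, linked F a (src G h) /\ linked F (tgt G h) b
    | linked F a (tgt G h) /\ linked F (src G h) b].
Proof.
apply: (@connect_closed_ind _ _
  (fun b => [\/ linked F a b, linked F a (src G h) /\ linked F (tgt G h) b
    | linked F a (tgt G h) /\ linked F (src G h) b])).
  by constructor 1; apply: linked0.
move=> x y Px /existsP[k /andP[]]; rewrite !inE => /orP[/eqP->|kF] kxy; last first.
  have xy := linked_joins kF kxy.
  case: Px => [ax|[ax xy']|[ax xy']].
  - by constructor 1; apply: linked_trans ax xy.
  - by constructor 2; split=> //; apply: linked_trans xy' xy.
  - by constructor 3; split=> //; apply: linked_trans xy' xy.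
case/joinsE: kxy => -[? ?]; subst x y.
- case: Px => [ax|[ax xy']|[ax xy']].
  + by constructor 2; split=> //; apply: linked0.
  + by constructor 2; split=> //; apply: linked0.
  + by constructor 1.
- case: Px => [ax|[ax xy']|[ax xy']].
  + by constructor 3; split=> //; apply: linked0.
  + by constructor 1.
  + by constructor 3; split=> //; apply: linked0.
Qed.

Lemma linkedU1_id F h a b : linked F (src G h) (tgt G h) ->
  linked (h |: F) a b = linked F a b.
Proof.
move=> hh; apply/idP/idP; last exact/linked_sub/finset.subsetUr.
case/linkedU1=> [//|[ax xb]|[ax xb]].
  exact: linked_trans ax (linked_trans hh xb).
by apply: linked_trans ax (linked_trans _ xb); rewrite linkedC.
Qed.

(** Every path from [a] to [b] in [h |: F] crosses [h], so inside [F] one end of [h] is linked to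
    [a] and the other to [b]; the link between [a] and [b] in [F'] closes the gap. *)
Lemma linked_exchange F F' h a b : F \subset F' -> linked F' a b ->
  linked (h |: F) a b -> ~~ linked F a b -> linked F' (src G h) (tgt G h).
Proof.
move=> sFF' ab /linkedU1[->//|[]|[]] /(linked_sub sFF') ax /(linked_sub sFF') xb _.
- rewrite linkedC in ax; apply: linked_trans ax (linked_trans ab _).
  by rewrite linkedC.
- rewrite linkedC; rewrite linkedC in ax.
  apply: linked_trans ax (linked_trans ab _).
  by rewrite linkedC.
Qed.

Lemma linked_set0 a b : linked finset.set0 a b -> a = b.
Proof.
apply: (@connect_closed_ind _ _ (fun b => a = b)) => // x y _ /existsP[k].
by rewrite inE.
Qed.

(** Independence in the graphic matroid, an edge-by-edge form of acyclicity that avoids handling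
    cycles as sequences. *)
Definition independent F :=
  [forall h in F, ~~ linked (F :\ h) (src G h) (tgt G h)].

Lemma independentP F :
  reflect (forall h, h \in F -> ~~ linked (F :\ h) (src G h) (tgt G h))
    (independent F).
Proof. exact: forall_inP. Qed.

(** A minimal [D] inside [F] that links the ends of [e] forms a circuit with [e], so any [h] in [D]
    is bypassed by the rest; [D] is nonempty because [e] is not a loop. *)
Lemma linked_circuit F e : src G e != tgt G e ->
  linked F (src G e) (tgt G e) ->
  exists2 h, h \in F & linked (e |: F :\ h) (src G h) (tgt G h).
Proof.
move=> ne eF.
have [D /minsetP[eD minD] sDF] :=
  @minset_exists _ (fun D => linked D (src G e) (tgt G e)) F eF.
have [D0|[h hD]] := finset.set_0Vmem D.
  by move: eD ne; rewrite D0 => /linked_set0 ->; rewrite eqxx.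
exists h; first exact: (fintype.subsetP sDF).
rewrite finset.setUC; apply: (@linked_exchange (D :\ h) _ h (src G e) (tgt G e)).
- apply: fintype.subset_trans (finset.subsetUl _ _); exact: finset.setSD.
- by apply: linked_edge; rewrite !inE eqxx orbT.
- by rewrite finset.setD1K.
- apply/negP => /minD eqD; move: hD; rewrite -eqD ?inE ?eqxx //.
  exact: finset.subD1set.
Qed.

(** Turns a vertex path into the list format of [is_cycle]; the last vertex is omitted, since the
    closing edge supplies it. *)
Fixpoint steps (ed : V -> V -> E) x (p : seq V) : seq (V * E) :=
  if p is y :: p' then (x, ed x y) :: steps ed y p' else [::].

Lemma unzip1_steps ed x p : unzip1 (steps ed x p) = belast x p.
Proof. by elim: p x => //= y p IHp x; rewrite IHp. Qed.

Lemma steps_edges ed F x p :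
  (forall y z, adj G F y z -> (ed y z \in F) && joins G (ed y z) y z) ->
  path (adj G F) x p -> forall k, k \in unzip2 (steps ed x p) ->
  [&& k \in F, src G k \in x :: p & tgt G k \in x :: p].
Proof.
move=> edP; elim: p x => //= y p IHp x /andP[xy yp] k.
have /andP[eF exy] := edP _ _ xy.
rewrite in_cons => /orP[/eqP->|].
  by rewrite eF; case/joinsE: exy => -[<- <-]; rewrite !in_cons !eqxx !orbT.
move=> /(IHp _ yp) /and3P[-> ks kt].
by rewrite ![_ \in x :: _]in_cons ks kt !orbT.
Qed.

Lemma uniq_steps ed F x p :
  (forall y z, adj G F y z -> (ed y z \in F) && joins G (ed y z) y z) ->
  path (adj G F) x p -> uniq (x :: p) -> uniq (unzip2 (steps ed x p)).
Proof.
move=> edP; elim: p x => //= y p IHp x /andP[xy yp] /andP[xp up].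
rewrite (IHp _ yp) // andbT; apply/negP => /(steps_edges edP yp) /and3P[_ ks kt].
have /andP[_ /joinsE] := edP _ _ xy.
by case=> -[ax _]; move: xp; rewrite ax ?ks ?kt.
Qed.

Lemma path_steps ed F x p (p0 q : V * E) :
  (forall y z, adj G F y z -> (ed y z \in F) && joins G (ed y z) y z) ->
  path (adj G F) x p -> joins G p0.2 p0.1 x -> q.1 = last x p ->
  path (fun p q : V * E => joins G p.2 p.1 q.1) p0 (rcons (steps ed x p) q).
Proof.
move=> edP; elim: p x p0 => [|y p IHp] x p0 /=; first by move=> _ ? ->; rewrite andbT.
move=> /andP[xy yp] j0 ql; rewrite j0 /=.
by apply: IHp => //=; have /andP[] := edP _ _ xy.
Qed.

Lemma path_linked F (p0 q : V * E) s :
  path (fun p q : V * E => joins G p.2 p.1 q.1) p0 (rcons s q) ->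
  all (fun e => e \in F) (unzip2 s) ->
  exists2 w, joins G p0.2 p0.1 w & linked F w q.1.
Proof.
elim: s p0 => [|p1 s IHs] p0 /=.
  by rewrite andbT => j _; exists q.1 => //; apply: linked0.
move=> /andP[j0 /IHs{}IHs] /andP[p1F /IHs[w j1 wq]].
by exists p1.1 => //; apply: linked_trans wq; apply: linked_joins j1.
Qed.

(** A cycle through [h] links the ends of [h] without using [h]; conversely, [h] closes a simple
    path between its ends that avoids it. *)
Lemma acyclicP F : reflect (acyclic G F) (independent F).
Proof.
apply: (iffP (independentP F)) => [indF s|acF h hF].
  apply/negP => /and5P[]; case: s => // -[v h] s _ _.
  rewrite [uniq (unzip2 _)]/= => /andP[hs _].
  rewrite [all _ _]/= => /andP[hF sF] cyc.
  have sF' : all (fun e => e \in F :\ h) (unzip2 s).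
    apply/allP => k ks; rewrite !inE (allP sF) // andbT.
    by apply: contraNneq hs => <-.
  have [w /= jw wv] := path_linked cyc sF'.
  by have /negP := indF h hF; rewrite -(linked_ends _ jw) linkedC.
apply/negP; rewrite linkedC => /connectP[p0 pP0 lastP0].
case/shortenP: pP0 lastP0 => p pP up _ lastp.
(* The default [h] is never taken between vertices adjacent in [F :\ h]. *)
pose ed y z := odflt h [pick k in F :\ h | joins G k y z].
have edP y z : adj G (F :\ h) y z ->
    (ed y z \in F :\ h) && joins G (ed y z) y z.
  rewrite /ed; case: pickP => [k //|no] /existsP[k].
  by rewrite [_ && _]no.
have/negP[] := acF ((src G h, h) :: steps ed (tgt G h) p).
apply/and5P; split => //.
- rewrite [unzip1 _]/= unzip1_steps lastp -/(uniq (_ :: _)) /=.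
  by move: up; rewrite lastI rcons_uniq.
- rewrite /= (uniq_steps edP pP up) andbT; apply/negP.
  by move=> /(steps_edges edP pP); rewrite !inE eqxx.
- rewrite /= hF; apply/allP => k /(steps_edges edP pP).
  by rewrite !inE => /and3P[/andP[]].
- by apply: (path_steps edP pP) => //; apply: joins_ends.
Qed.

Lemma spanning_treeE F :
  spanning_tree G F = spanning_connected G F && independent F.
Proof. by rewrite /spanning_tree; congr (_ && _); apply/asboolP/acyclicP. Qed.

End Connectivity.

(** * Spanning trees: existence and exchange *)

Section SpanningTrees.
Variables (V E : finType) (G : mgraph V E).
Implicit Types (F T : {set E}) (a b x y : V) (e h : E).

Lemma spanning_connectedP F x0 : x0 \in vset G ->
  reflect {in vset G &, forall a b, linked G F a b} (spanning_connected G F).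
Proof.
move=> x0V; rewrite /spanning_connected (_ : (0 < #|vset G|)%N); last first.
  by apply/card_gt0P; exists x0.
apply: (iffP forall_inP) => [sc a b aV bV|sc a aV].
  exact: (forall_inP (sc a aV)).
by apply/forall_inP => b bV; apply: sc.
Qed.

Lemma spanning_tree_linked F a b :
  spanning_tree G F -> a \in vset G -> b \in vset G -> linked G F a b.
Proof. by case/andP=> + _ aV bV => /(spanning_connectedP _ aV); apply. Qed.

Lemma spanning_tree_independent F h : spanning_tree G F -> h \in F ->
  ~~ linked G (F :\ h) (src G h) (tgt G h).
Proof. by rewrite spanning_treeE => /andP[_ /independentP]; apply. Qed.

(** In a minimal connecting edge set, an edge whose ends stay linked without it could be dropped. *)
Lemma spanning_tree_exists : connected_graph G -> exists F, spanning_tree G F.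
Proof.
move=> cG; have [F /minsetP[scF minF]] :=
  @ex_minset _ (spanning_connected G) (ex_intro (fun F => spanning_connected G F) _ cG).
exists F; rewrite spanning_treeE scF /=; apply/independentP => h hF.
apply/negP => hh; have := scF; rewrite -(finset.setD1K hF) => scF'.
have /minF-/(_ (finset.subD1set _ _)) eqF : spanning_connected G (F :\ h).
  apply/(spanning_connectedP _ (src_in G h)) => a b aV bV.
  rewrite -(linkedU1_id _ _ hh).
  by apply: (spanning_connectedP _ (src_in G h) scF').
by move: hF; rewrite -eqF !inE eqxx.
Qed.

(** Basis exchange: [F] is a tree less [h], and [k] reconnects its two components just as [h]
    did. *)
Lemma spanning_treeU1 F h k : h \notin F -> spanning_tree G (h |: F) ->
  ~~ linked G F (src G k) (tgt G k) -> spanning_tree G (k |: F).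
Proof.
move=> hF treeh nk; rewrite spanning_treeE.
have hkF : linked G (k |: F) (src G h) (tgt G h).
  apply: (@linked_exchange _ _ G F _ h (src G k) (tgt G k)) => //.
  - exact: finset.subsetUr.
  - by apply: linked_edge; rewrite !inE eqxx.
  - by apply: spanning_tree_linked treeh _ _; rewrite ?src_in ?tgt_in.
apply/andP; split.
  apply/(spanning_connectedP _ (src_in G h)) => a b aV bV.
  rewrite -(linkedU1_id _ _ hkF).
  apply: linked_sub (spanning_tree_linked treeh aV bV).
  by apply: finset.setUS; apply: finset.subsetUr.
apply/independentP => m; rewrite !inE => /predU1P[->|mF].
  apply: contra nk; apply: linked_sub; apply/fintype.subsetP => i.
  by rewrite !inE => /andP[/negPf->].
have mh : m != h by apply: contraNneq hF => <-.
have nm : ~~ linked G (F :\ m) (src G m) (tgt G m).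
  have := spanning_tree_independent treeh (_ : m \in h |: F).
  rewrite !inE mF orbT => /(_ isT); apply: contra; apply: linked_sub.
  by apply: finset.setSD; apply: finset.subsetUr.
apply/negP => mk; move/negP: nk; apply.
apply: (@linked_exchange _ _ G (F :\ m) _ k (src G m) (tgt G m)) => //.
- exact: finset.subD1set.
- exact: linked_edge.
- apply: linked_sub mk; apply/fintype.subsetP => i; rewrite !inE.
  by case/andP=> -> /orP[->|->]; rewrite ?orbT.
Qed.

End SpanningTrees.

(** * Contraction of an edge *)

Section Contraction.
Variables (V E : finType) (G : mgraph V E) (e : E).
Implicit Types (F T : {set E}) (a b x y : V) (h : E).
Let u := src G e.
Let v := tgt G e.
Let G' := Defs.contract G u v.
Let pi := identify u v.

Lemma linked_identify F a : linked G (e |: F) a (pi a).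
Proof.
rewrite /pi /identify; case: eqP => [->|_]; last exact: linked0.
by rewrite linkedC; apply: linked_edge; rewrite !inE eqxx.
Qed.

(** For connectivity, identifying the ends of [e] amounts to having [e] available for free. *)
Lemma linked_contract F a b : linked G' F (pi a) (pi b) = linked G (e |: F) a b.
Proof.
apply/idP/idP => [ab|].
  rewrite (linked_eqr _ (linked_identify F b)) (linked_eql _ (linked_identify F a)).
  apply: connect_sub ab => x y /existsP[k /andP[kF /joinsE kxy]].
  have stk : linked G (e |: F) (pi (src G k)) (pi (tgt G k)).
    rewrite -(linked_eqr _ (linked_identify F _)) -(linked_eql _ (linked_identify F _)).
    by apply: linked_edge; rewrite !inE kF orbT.
  by case: kxy => -[-> ->] //; rewrite -/(linked _ _ _ _) linkedC.
apply: (@connect_closed_ind _ _ (fun b => linked G' F (pi a) (pi b))).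
  exact: linked0.
move=> x y ax /existsP[k /andP[]].
have euv : pi u = pi v.
  by rewrite /pi /identify eqxx; case: eqP.
rewrite !inE => /predU1P[->|kF] /joinsE kxy.
  by case: kxy ax => -[-> ->]; rewrite -/u -/v euv.
apply: linked_trans ax _; apply: (@linked_joins _ _ _ _ k) => //.
by rewrite /joins; case: kxy => -[-> ->]; rewrite !eqxx ?orbT.
Qed.

Hypothesis not_loop : u != v.

Lemma spanning_tree_contract F :
  spanning_tree G' F = (e \notin F) && spanning_tree G (e |: F).
Proof.
have eloop : linked G' finset.set0 (src G' e) (tgt G' e).
  rewrite (_ : src G' e = tgt G' e) ?linked0 //=.
  by rewrite /identify eqxx; case: eqP.
have scE : spanning_connected G' F = spanning_connected G (e |: F).
  apply/(spanning_connectedP _ (src_in G' e))/(spanning_connectedP _ (src_in G e)).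
    move=> sc a b aV bV; rewrite -linked_contract.
    by apply: sc; apply: imset_f.
  move=> sc _ _ /imsetP[a aV ->] /imsetP[b bV ->].
  by rewrite [linked _ _ _ _]linked_contract; apply: sc.
rewrite !spanning_treeE scE andbCA; congr (_ && _).
apply/independentP/andP => [ind|[eF /independentP ind] h hF]; last first.
  rewrite [linked _ _ _ _]linked_contract.
  have he : h != e by apply: contraNneq eF => <-.
  have := ind h; rewrite !inE hF orbT => /(_ isT); apply: contra.
  apply: linked_sub; apply/fintype.subsetP => i; rewrite !inE.
  by case/predU1P=> [->|/andP[-> ->]]; rewrite ?orbT // eqxx eq_sym he.
have eF : e \notin F.
  apply/negP => /ind /negP; apply; apply: linked_sub eloop.
  exact: finset.sub0set.
split=> //; apply/independentP => h; rewrite !inE => /predU1P[->|hF].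
  (* If [F] linked the ends of [e], a circuit through [e] would contract to a circuit inside [F]. *)
  apply/negP => ee; have [] := linked_circuit not_loop (_ : linked G F u v).
    by apply: linked_sub ee; apply/fintype.subsetP => i; rewrite !inE => /andP[/negPf->].
  by move=> k kF; rewrite -linked_contract; apply/negP/ind.
have := ind h hF; rewrite [linked _ _ _ _]linked_contract; apply: contra.
apply: linked_sub; apply/fintype.subsetP => i; rewrite !inE.
by case/andP=> -> /orP[->|->]; rewrite ?orbT.
Qed.

End Contraction.

(** * Weighted tree sums, Kirchhoff currents and negative correlation *)

Section Weights.
Variables (R : realType) (V E : finType) (G : mgraph V E).
Implicit Types (F T : {set E}) (a b x y : V) (e g h : E) (l : E -> R).

Definition weight l T := \prod_(h | h \notin T) l h.

Definition tree_sum l (P : pred {set E}) :=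
  \sum_(T | spanning_tree G T && P T) weight l T.

Lemma tauE l : tau G l = tree_sum l xpredT.
Proof. by apply: eq_bigl => T; rewrite andbT. Qed.

Lemma weightD1 l T h : h \in T -> weight l (T :\ h) = l h * weight l T.
Proof.
move=> hT; rewrite /weight (bigD1 h) /= ?inE ?eqxx //; congr (_ * _).
apply: eq_bigl => k; rewrite !inE; case: (eqVneq k h) => [->|_] //=.
  by rewrite hT.
by rewrite andbT.
Qed.

Lemma weight_gt0 l T : (forall h, 0 < l h) -> 0 < weight l T.
Proof. by move=> l0; apply: prodr_gt0. Qed.

Lemma tree_sum_ge0 l P : (forall h, 0 < l h) -> 0 <= tree_sum l P.
Proof. by move=> l0; apply: sumr_ge0 => T _; apply/ltW/weight_gt0. Qed.

Lemma tree_sum_le l (P Q : pred {set E}) : (forall h, 0 < l h) ->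
  (forall T, P T -> Q T) -> tree_sum l P <= tree_sum l Q.
Proof.
move=> l0 PQ; rewrite /tree_sum [leLHS]big_mkcondr [leRHS]big_mkcondr /=.
apply: ler_sum => T _; have w0 := ltW (weight_gt0 T l0).
by have := PQ T; case: (P T) => [-> //|_]; case: (Q T).
Qed.

Lemma tau_gt0 l : connected_graph G -> (forall h, 0 < l h) -> 0 < tau G l.
Proof.
move=> /spanning_tree_exists[T treeT] l0; rewrite /tau (bigD1 T) //=.
rewrite ltr_wpDr ?weight_gt0 //; apply: sumr_ge0 => F _.
exact/ltW/weight_gt0.
Qed.

(** Deleting [h] and adding it back are inverse to each other; this serves both the contraction
    formula and Kirchhoff's law. *)
Lemma sum_trees_edge h (f : {set E} -> {set E} -> R) :
  \sum_(T | spanning_tree G T && (h \in T)) f T (T :\ h) =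
  \sum_(F : {set E} | (h \notin F) && spanning_tree G (h |: F)) f (h |: F) F.
Proof.
rewrite (reindex_onto (fun F : {set E} => h |: F) (fun T : {set E} => T :\ h)) /=; last first.
  by move=> T /andP[_ hT]; rewrite finset.setD1K.
apply: eq_big => [F|F /andP[_ /eqP-> //]].
rewrite !inE eqxx andbT andbC; congr (_ && _).
apply/eqP/idP => [<-|hF]; first by rewrite !inE eqxx.
exact: finset.setU1K.
Qed.

(** Removing [e] from a tree through [e] moves [l e] into the product over the complement. *)
Lemma tau_contract l e : src G e != tgt G e ->
  tau (Defs.contract G (src G e) (tgt G e)) l =
  l e * tree_sum l (fun T => e \in T).
Proof.
move=> ne; rewrite /tau /tree_sum big_distrr /=.
rewrite [RHS](eq_bigr (fun T => weight l (T :\ e))); last first.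
  by move=> T /andP[_ eT]; rewrite weightD1.
rewrite (sum_trees_edge e (fun _ F => weight l F)).
by apply: eq_bigl => F; rewrite spanning_tree_contract.
Qed.

(* [flow T h a b] is the signed number of times that the path of the tree [T]
   from [a] to [b] crosses [h]: the component of [T :\ h] that contains
   [src G h] is left (1) or entered (-1). *)
Definition flow T h a b : R :=
  (linked G (T :\ h) a (src G h))%:R - (linked G (T :\ h) b (src G h))%:R.

Lemma flow_edge T h : spanning_tree G T -> h \in T ->
  flow T h (src G h) (tgt G h) = 1.
Proof.
move=> treeT hT; rewrite /flow linked0 linkedC.
by rewrite (negPf (spanning_tree_independent treeT hT)) subr0.
Qed.

(** The sum is [S a - S b]. Across a tree edge [k] only the summand [h = k] of [S] jumps, by the
    drop of [phi], because [k] survives in [T :\ h] for every other [h]; so [S - phi] is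
    constant. *)
Lemma flow_gradient T (phi : V -> R) a b : spanning_tree G T ->
  a \in vset G -> b \in vset G ->
  \sum_(h in T) flow T h a b * (phi (src G h) - phi (tgt G h)) = phi a - phi b.
Proof.
move=> treeT aV bV; have := spanning_tree_linked treeT aV bV.
pose S c := \sum_(h in T) (linked G (T :\ h) c (src G h))%:R
  * (phi (src G h) - phi (tgt G h)).
suff edgeS k : k \in T -> S (src G k) - S (tgt G k) = phi (src G k) - phi (tgt G k).
  move=> ab; transitivity (S a - S b).
    by rewrite /S -sumrB; apply: eq_bigr => h _; rewrite -mulrBl.
  suff : S a - phi a = S b - phi b by lra.
  move: ab; apply: (@connect_closed_ind _ _ (fun b => S a - phi a = S b - phi b)).
    by [].
  move=> x y -> /existsP[k /andP[kT kxy]]; have := edgeS k kT.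
  by case/joinsE: kxy => -[-> ->]; lra.
move=> kT; rewrite /S -sumrB (bigD1 k) //= big1 ?addr0 => [|h /andP[hT hk]].
  rewrite linked0 [linked _ _ (tgt G k) _]linkedC.
  by rewrite (negPf (spanning_tree_independent treeT kT)) mul0r mul1r subr0.
rewrite (linked_eql _ (_ : linked G (T :\ h) (src G k) (tgt G k))) ?subrr //.
by apply: linked_edge; rewrite !inE eq_sym hk.
Qed.

(** For positive [l], this is [tau G l] times the current in [h] when a unit current enters at [a]
    and leaves at [b]. *)
Definition current l h a b :=
  \sum_(T | spanning_tree G T && (h \in T)) weight l T * flow T h a b.

Lemma current_edge l h :
  current l h (src G h) (tgt G h) = tree_sum l (fun T => h \in T).
Proof.
by apply: eq_bigr => T /andP[treeT hT]; rewrite flow_edge ?mulr1.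
Qed.

(** A tree less one edge, that is, a spanning forest with two components. *)
Definition forest2 F := [exists h, (h \notin F) && spanning_tree G (h |: F)].

(** The unnormalised voltage, grounded at [b]. *)
Definition potential l a b x :=
  \sum_(F | forest2 F && ~~ linked G F a b) weight l F * (linked G F a x)%:R.

(* Kirchhoff's voltage law: removing [h] from a tree leaves a spanning forest
   with two components, and every such forest which separates the ends of [h]
   arises in this way. *)
Lemma current_potential l h a b : a \in vset G -> b \in vset G ->
  l h * current l h a b = potential l a b (src G h) - potential l a b (tgt G h).
Proof.
move=> aV bV; rewrite /current /potential big_distrr -sumrB /=.
rewrite (eq_bigr (fun T => weight l (T :\ h) *
  ((linked G (T :\ h) a (src G h))%:R - (linked G (T :\ h) b (src G h))%:R)));
  last by move=> T /andP[_ hT]; rewrite weightD1 // mulrA.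
rewrite (sum_trees_edge h (fun _ F => weight l F *
  ((linked G F a (src G h))%:R - (linked G F b (src G h))%:R))).
rewrite big_mkcond [RHS]big_mkcond; apply: eq_bigr => F _.
case: ifPn => [/andP[hF treeh]|nh]; last first.
  (* Here [h] does not complete the forest to a tree, so by exchange [F] already links the ends of
     [h] and the potential difference vanishes. *)
  case: ifPn => // /andP[/existsP[k /andP[kF treek]] _].
  rewrite (linked_eqr _ (_ : linked G F (src G h) (tgt G h))) ?subrr //.
  apply: contraNT nh => nh; apply/andP; split; last exact: spanning_treeU1 treek nh.
  by apply: contra nh => /linked_edge.
rewrite (_ : forest2 F) /=; last by apply/existsP; exists h; rewrite hF.
have sep : ~~ linked G F (src G h) (tgt G h).
  have := spanning_tree_independent treeh (_ : h \in h |: F).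
  by rewrite !inE eqxx finset.setU1K // => /(_ isT).
have side c : c \in vset G -> linked G F c (tgt G h) = ~~ linked G F c (src G h).
  move=> cV; have := spanning_tree_linked treeh cV (src_in G h).
  case cs: (linked G F c (src G h)).
    by move=> _; rewrite (linked_eql _ cs) (negPf sep).
  by case/linkedU1 => [|[]|[]] //; rewrite cs.
rewrite side //; have [ab|nab] := boolP (linked G F a b).
  by rewrite /= (linked_eql _ ab) subrr mulr0.
(* As [a] and [b] lie in different components, [b] is on the source side exactly when [a] is on the
   target side. *)
rewrite /= -mulrBr; congr (_ * (_ - (nat_of_bool _)%:R)).
apply/idP/idP => [bs|nas].
  by apply: contra nab => as_; rewrite (linked_eqr _ bs).
apply: contraNT nab; rewrite -side // => bt.
by rewrite (linked_eqr _ bt) side.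
Qed.
(** Only the current for [l'] is expanded over trees. The other factor is a potential difference, so
    by [flow_gradient] each tree contributes its weight times the same drop across [e]. *)
Lemma current_energy l l' e :
  \sum_h l h * current l h (src G e) (tgt G e) * current l' h (src G e) (tgt G e)
  = tau G l' * (l e * tree_sum l (fun T => e \in T)).
Proof.
set a := src G e; set b := tgt G e.
have aV : a \in vset G := src_in G e.
have bV : b \in vset G := tgt_in G e.
rewrite -current_edge (current_potential _ _ aV bV) -/a -/b.
set psi := potential l a b.
transitivity (\sum_h \sum_(T | spanning_tree G T && (h \in T))
    weight l' T * (flow T h a b * (psi (src G h) - psi (tgt G h)))).
  apply: eq_bigr => h _; rewrite (current_potential _ _ aV bV) mulrC.
  by rewrite /current big_distrl /=; apply: eq_bigr => T _; rewrite mulrA.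
rewrite (exchange_big_dep (spanning_tree G)) /=; last by move=> h T _ /andP[].
rewrite /tau big_distrl /=; apply: eq_bigr => T treeT.
rewrite -big_distrr /= -(flow_gradient psi treeT aV bV); congr (_ * _).
by apply: eq_bigl => h; rewrite treeT.
Qed.

(* Doubling [l g] leaves the current through [g] unchanged, so subtracting the
   two instances of [current_energy] for [l] and the doubled weights leaves a
   multiple of the square of that current. *)
Lemma negative_correlation l e g : (forall h, 0 < l h) -> e != g ->
  tau G l * tree_sum l (fun T => (e \in T) && (g \in T)) <=
  tree_sum l (fun T => e \in T) * tree_sum l (fun T => g \in T).
Proof.
move=> l0 eg; pose l' h := if h == g then l g *+ 2 else l h.
(* [l g] enters the weight of exactly those trees that avoid [g]. *)
have w' T : weight l' T = weight l T *+ (if g \in T then 1 else 2).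
  rewrite /weight; case: ifPn => gT.
    by apply: eq_bigr => h hT; rewrite /l'; case: eqP hT => // ->; rewrite gT.
  rewrite (bigD1 g) //= [in RHS](bigD1 g) //= /l' eqxx mulrnAl; congr (_ * _ *+ _).
  by apply: eq_bigr => h /andP[_ /negPf->].
have cE : current l' g (src G e) (tgt G e) = current l g (src G e) (tgt G e).
  by apply: eq_bigr => T /andP[_ gT]; rewrite w' gT.
have sum' P : tree_sum l' P = tree_sum l P *+ 2 - tree_sum l (fun T => P T && (g \in T)).
  rewrite /tree_sum -sumrMnl.
  rewrite [X in _ - X](eq_bigl (fun T => (spanning_tree G T && P T) && (g \in T))); last first.
    by move=> T; rewrite andbA.
  rewrite [X in _ - X]big_mkcondr -sumrB; apply: eq_bigr => T _.
  by rewrite w'; case: ifP => _; rewrite ?subr0 // mulr1n mulr2n addrK.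
have := current_energy l' l e; have := current_energy l l' e.
rewrite (_ : l' e = l e) /l' ?(negPf eg) // -/l' !tauE !sum' /=.
set t := tree_sum l xpredT; set Ne := tree_sum l (fun T => e \in T).
set Ng := tree_sum l (fun T => g \in T).
set Neg := tree_sum l (fun T => (e \in T) && _).
rewrite (bigD1 g) //= cE => E1; rewrite (bigD1 g) //= cE /l' eqxx => E2.
have EE : \sum_(i | i != g) l i * current l i (src G e) (tgt G e) *
    current l' i (src G e) (tgt G e) =
  \sum_(i | i != g) (if i == g then l g *+ 2 else l i) *
    current l' i (src G e) (tgt G e) * current l i (src G e) (tgt G e).
  by apply: eq_bigr => i /negPf->; rewrite mulrAC.
rewrite -(ler_pM2l (l0 e)) -subr_ge0.
suff -> : l e * (Ne * Ng) - l e * (t * Neg) =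
    l g * current l g (src G e) (tgt G e) ^+ 2.
  by rewrite mulr_ge0 ?sqr_ge0 // ltW.
move: E1 E2; rewrite EE; lra.
Qed.
End Weights.

(** * Calculus of sums and products, and invariance of the nonnegative orthant *)

Section Analysis.
Variable R : realType.
Implicit Types (f g : R -> R) (t : R).

Lemma is_derive_ext f g t (d : R) : f =1 g -> is_derive t 1 f d -> is_derive t 1 g d.
Proof. by move=> /funext ->. Qed.

Lemma is_derive_bigsum (I : Type) (r : seq I) (P : pred I) (f : I -> R -> R)
    (d : I -> R) t :
  (forall i, P i -> is_derive t 1 (f i) (d i)) ->
  is_derive t 1 (fun s => \sum_(i <- r | P i) f i s) (\sum_(i <- r | P i) d i).
Proof.
move=> fP; elim: r => [|i r IHr].
  rewrite big_nil; apply: is_derive_ext (is_derive_cst 0 _ _) => s.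
  by rewrite big_nil.
rewrite big_cons; case: ifPn => Pi.
  apply: is_derive_ext (is_deriveD (fP i Pi) IHr) => s.
  by rewrite big_cons Pi.
by apply: is_derive_ext IHr => s; rewrite big_cons (negPf Pi).
Qed.

(** The logarithmic form makes the derivative of a tree weight a multiple of that same weight. *)
Lemma is_derive_bigprod (I : Type) (r : seq I) (P : pred I) (f : I -> R -> R)
    (d : I -> R) t :
  (forall i, P i -> f i t != 0) ->
  (forall i, P i -> is_derive t 1 (f i) (d i)) ->
  is_derive t 1 (fun s => \prod_(i <- r | P i) f i s)
    ((\prod_(i <- r | P i) f i t) * \sum_(i <- r | P i) d i / f i t).
Proof.
move=> f0 fP; elim: r => [|i r IHr].
  rewrite !big_nil mulr0; apply: (is_derive_ext _ (is_derive_cst (1:R) t 1)) => s.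
  by rewrite big_nil.
rewrite !big_cons; case: ifPn => Pi.
  have fd := is_deriveM (fP i Pi) IHr.
  apply: is_derive_eq; first by apply: is_derive_ext fd => s; rewrite big_cons Pi.
  rewrite /GRing.scale /=; have := f0 i Pi.
  by move: (\prod_(_ <- _ | _) _) (\sum_(_ <- _ | _) _) => p q ?; field.
by apply: is_derive_ext IHr => s; rewrite big_cons (negPf Pi).
Qed.

Lemma cvg_bigsum (I S : Type) (F : set_system S) (FF : Filter F) (r : seq I)
    (P : pred I) (f : I -> S -> R) (a : I -> R) :
  (forall i, P i -> (f i @ F --> a i)%classic) ->
  ((fun s => \sum_(i <- r | P i) f i s) @ F --> \sum_(i <- r | P i) a i)%classic.
Proof. exact: (@cvg_big _ _ +%R 0 P (@add_continuous R)). Qed.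

Lemma cvg_bigprod (I S : Type) (F : set_system S) (FF : Filter F) (r : seq I)
    (P : pred I) (f : I -> S -> R) (a : I -> R) :
  (forall i, P i -> (f i @ F --> a i)%classic) ->
  ((fun s => \prod_(i <- r | P i) f i s) @ F --> \prod_(i <- r | P i) a i)%classic.
Proof.
move=> fa; elim: r => [|i r IHr].
  by rewrite big_nil; under eq_fun do rewrite big_nil; apply: cvg_cst.
rewrite big_cons; under eq_fun do rewrite big_cons.
by case: ifPn => // Pi; apply: cvgM => //; apply: fa.
Qed.

(** The squared negative part; squaring makes it differentiable at zero. *)
Definition sqneg (x : R) := Num.min x 0 ^+ 2.

(** The derivative [2 * Num.min x 0] is 2-Lipschitz, which gives this remainder. *)
Lemma sqneg_taylor (x y : R) :
  `|sqneg y - sqneg x - 2 * Num.min x 0 * (y - x)| <= (y - x) ^+ 2.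
Proof.
rewrite /sqneg ler_norml.
have min0 (z : R) : [/\ Num.min z 0 <= 0, 0 <= z - Num.min z 0
    & Num.min z 0 * (z - Num.min z 0) = 0].
  by rewrite minEle; case: (leP z 0) => hz; split; lra.
case: (min0 x) (min0 y); move: (Num.min x 0) (Num.min y 0) => a b.
move=> a0 xa axa [b0 yb byb].
have := mulr_ge0 xa (_ : 0 <= - b); rewrite oppr_ge0 => /(_ b0) h1.
have := mulr_ge0 yb (_ : 0 <= - a); rewrite oppr_ge0 => /(_ a0) h2.
by apply/andP; split; have := sqr_ge0 (y - b - (x - a)); have := sqr_ge0 (a - b); nra.
Qed.

Lemma is_derive_sqneg (x : R) : is_derive x 1 sqneg (2 * Num.min x 0).
Proof.
suff cvg : ((fun h : R => h^-1 *: ((sqneg \o shift x) (h *: 1) - sqneg x))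
    @ 0^' --> (2 * Num.min x 0 : R))%classic.
  apply: DeriveDef; first by apply/cvg_ex; exists (2 * Num.min x 0).
  exact: cvg_lim cvg.
apply/cvgrPdist_le => eps eps0; near=> h => /=.
have h0 : h != 0 by near: h; exact: nbhs_dnbhs_neq.
apply: (@le_trans _ _ `|h|); last by near: h; exact: dnbhs0_le.
rewrite -(ler_pM2l (_ : 0 < `|h|)) ?normr_gt0 // -normrM -expr2 real_normK ?num_real //.
have := sqneg_taylor x (x + h); rewrite (_ : x + h - x = h); last ring.
rewrite distrC.
apply: le_trans; rewrite le_eqVlt; apply/orP; left; apply/eqP; congr `|_|.
rewrite /GRing.scale /= mulr1 [h + x]addrC; field.
Unshelve. all: by end_near. Qed.

(* For [u := \sum_e (min (K e) 0)^2] the sign condition gives [u' <= C u]. *)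
Lemma metzler_invariance (I : finType) (b M : R) (K : I -> R -> R)
    (A : I -> I -> R -> R) :
  0 <= b -> 0 <= M ->
  (forall i, ({within `[0, b], continuous (K i)})%classic) ->
  (forall i t, t \in `]0, b[ ->
     is_derive t 1 (K i) (\sum_j A i j t * K j t)) ->
  (forall i j t, t \in `]0, b[ -> i != j -> 0 <= A i j t) ->
  (forall i j t, t \in `]0, b[ -> `|A i j t| <= M) ->
  (forall i, 0 <= K i 0) -> forall i, 0 <= K i b.
Proof.
move=> b0 M0 Kcont Kder Apos AM K0 i0.
pose m i t := Num.min (K i t) 0.
pose u t := \sum_i sqneg (K i t).
(* Each pair [i], [j] adds at most [M * (m i t ^+ 2 + m j t ^+ 2)] to [du t]; summed over all pairs
   this is [C * u t]. *)
pose C : R := 2 * M * #|I|%:R.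
pose du t := \sum_i 2 * m i t * \sum_j A i j t * K j t.
have uder t : t \in `]0, b[ -> is_derive t 1 u (du t).
  move=> tb; apply: is_derive_bigsum => i _.
  have := Kder i t tb => Kd.
  exact: (is_derive1_comp (is_derive_sqneg (K i t)) Kd).
have mle0 i t : m i t <= 0 by rewrite /m ge_min lexx orbT.
have du_le t : t \in `]0, b[ -> du t <= C * u t.
  move=> tb; rewrite /du /C /u.
  have mm i j : m i t * (A i j t * K j t) <= M * ((m i t ^+ 2 + m j t ^+ 2) / 2).
    have := AM i j t tb; rewrite ler_norml => /andP[A1 A2].
    have := mle0 i t; have := mle0 j t.
    have mK : m j t <= K j t by rewrite /m ge_min lexx.
    (* A diagonal coefficient has no assumed sign, but there the product is [A i i t * m i t ^+ 2]
       and the bound [M] suffices. *)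
    have [ij|ij] := eqVneq i j.
      subst j; have mKi : m i t * K i t = m i t ^+ 2.
        by rewrite /m minEle; case: ifP => _; rewrite ?mul0r ?expr0n.
      rewrite mulrCA mKi => _ _; have := sqr_ge0 (m i t); nra.
    have := Apos i j t tb ij; move: (A i j t) A1 A2 => a A1 A2 a0 mj mi.
    (* Since [m i t <= 0 <= a], replacing [K j t] by the smaller [m j t] can only increase the
       product. *)
    have h1 : m i t * (a * K j t) <= a * (m i t * m j t).
      rewrite mulrCA; apply: ler_wpM2l => //; exact: ler_wnM2l.
    apply: le_trans h1 _; have := sqr_ge0 (m i t - m j t).
    have : 0 <= m i t * m j t by exact: mulr_le0.
    nra.
  have -> : \sum_i 2 * m i t * (\sum_j A i j t * K j t) =
      \sum_i \sum_j 2 * (m i t * (A i j t * K j t)).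
    by apply: eq_bigr => i _; rewrite big_distrr /=; apply: eq_bigr => j _; rewrite mulrA.
  have -> : 2 * M * #|I|%:R * \sum_i sqneg (K i t) =
      \sum_i \sum_j 2 * (M * ((m i t ^+ 2 + m j t ^+ 2) / 2)).
    transitivity (\sum_i \sum_(j : I) (M * m i t ^+ 2 + M * m j t ^+ 2)).
      under [RHS]eq_bigr => i _ do rewrite big_split /= sumr_const.
      rewrite [RHS]big_split /= sumr_const sumrMnl -big_distrr /=.
      rewrite (_ : \sum_i sqneg (K i t) = \sum_i m i t ^+ 2) //.
      by rewrite -mulrnAr -[RHS]mulr2n -[_ *+ #|I|]mulr_natr -[RHS]mulr_natl; ring.
    by do 2!apply: eq_bigr => ? _; field.
  by do 2!apply: ler_sum => ? _; rewrite ler_pM2l // mm.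
have ucont : ({within `[0, b], continuous u})%classic.
  apply/subspace_continuousP => x xb; apply: cvg_bigsum => i _.
  have Kx := iffLR (subspace_continuousP _ _) (Kcont i) x xb.
  apply: (cvg_comp _ _ Kx); apply: differentiable_continuous.
  by apply/derivable1_diffP; case: (is_derive_sqneg (K i x)).
(* Gronwall's integrating factor: [H] is nonincreasing and starts at zero. *)
pose H t := expR (- C * t) * u t.
have Hder t : t \in `]0, b[ -> is_derive t 1 H (expR (- C * t) * (du t - C * u t)).
  move=> tb; have ud := uder t tb.
  have ed : is_derive t 1 (fun t => expR (- C * t)) (expR (- C * t) * - C).
    apply: (@is_derive1_comp _ expR (fun t => - C * t)).
    have := is_deriveZ (- C) (is_derive_id t 1).
    by rewrite /GRing.scale /= mulr1.
  apply: (is_derive_eq (is_deriveM ed ud)).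
  rewrite /GRing.scale /=; ring.
have Hcont : ({within `[0, b], continuous H})%classic.
  move=> x; apply: (@cvgM _ (subspace _)); last exact: ucont.
  apply: (@continuous_subspaceT _ _ _ (fun t => expR (- C * t))) => {}x.
  apply: (@continuous_comp _ _ _ ( *%R (- C)) expR); last exact: continuous_expR.
  exact: mulrl_continuous.
have Hb : H b <= H 0.
  have dH t : t \in `]0, b[ -> derivable H t 1 by move=> /Hder[].
  have dH0 t : t \in `]0, b[ -> (H^`())%classic t <= 0.
    move=> tb; have [_] := Hder t tb; rewrite derive1E => ->.
    by rewrite mulr_ge0_le0 ?expR_ge0 // subr_le0 du_le.
  have Hanti := ler0_derive1_le_cc dH dH0 Hcont.
  by apply: Hanti; rewrite ?in_itv /= ?lexx ?b0.
have u0 : u 0 = 0.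
  by rewrite /u big1 // => i _; rewrite /sqneg min_r ?expr0n.
have ub : u b <= 0.
  by move: Hb; rewrite /H u0 mulr0 pmulr_rle0 ?expR_gt0.
have sq0 i : 0 <= sqneg (K i b) by exact: sqr_ge0.
have : sqneg (K i0 b) <= 0.
  by apply: le_trans ub; rewrite /u (bigD1 i0) //= lerDl sumr_ge0.
rewrite leNgt; apply: contraR; rewrite -ltNge => Kneg.
by rewrite /sqneg min_l ?exprn_even_gt0 //= ?lt_eqF // ltW.
Qed.

End Analysis.

(** * Derivatives and continuity from relative difference quotients *)

Section DifferenceQuotients.
Variable R : realType.
Implicit Types (f : R -> R) (t : R) (D : set R).

Lemma is_derive_within f t (d : R) D : nbhs t D ->
  ((fun s => (f s - f t) / (s - t)) @ within D (dnbhs t) --> d)%classic ->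
  is_derive t 1 f d.
Proof.
move=> tD fd.
suff cvg : ((fun h : R => h^-1 *: ((f \o shift t) (h *: 1) - f t)) @ 0^'
    --> (d : R))%classic.
  apply: DeriveDef; first by apply/cvg_ex; exists d.
  exact: cvg_lim cvg.
apply/cvgrPdist_le => eps eps0.
have near_t : nbhs t (fun s => s != t -> `|d - (f s - f t) / (s - t)| <= eps).
  have near_s : nbhs t (fun s => s != t -> D s ->
    `|d - (f s - f t) / (s - t)| <= eps).
    exact: (cvgr_dist_le _ _ fd _ eps0).
  by apply: (filterS2 _ _ tD near_s) => s Ds sP st; exact: sP.
have near_0 := iffLR (nbhs0P _ _) near_t.
apply: (filterS _ near_0) => h /= hP h0.
have := hP; rewrite -subr_eq0 addrAC subrr add0r => /(_ h0).
by rewrite /GRing.scale /= mulr1 [h + t]addrC mulrC.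
Qed.

(** The increment of [f] is the quotient times [s - t], which tends to zero. This also covers time
    0, where the flow has only a one-sided derivative. *)
Lemma cvg_within_quotient f t (d : R) D :
  ((fun s => (f s - f t) / (s - t)) @ within D (dnbhs t) --> d)%classic ->
  (f @ within D (nbhs t) --> f t)%classic.
Proof.
move=> fd.
have st0 : ((fun s => s - t) @ within D (dnbhs t) --> (0 : R))%classic.
  have st : ((fun s => s - t) @ nbhs t --> t - t)%classic.
    by apply: (@cvgB _ _ _ (nbhs t)); [exact: cvg_id|exact: cvg_cst].
  rewrite subrr in st => P /st Pt.
  exact: (@filterS _ (nbhs t) _ _ _ (fun s Ps _ _ => Ps) Pt).
have prod0 : ((fun s => (f s - f t) / (s - t) * (s - t)) @ within D (dnbhs t)
    --> (0 : R))%classic by rewrite -(mulr0 d); exact: cvgM fd st0.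
apply/cvgrPdist_le => eps eps0.
have near_s : nbhs t (fun s => s != t -> D s ->
    `|0 - (f s - f t) / (s - t) * (s - t)| <= eps).
  exact: (cvgr_dist_le _ _ prod0 _ eps0).
(* The punctured neighbourhood leaves out [s = t], where the bound is trivial. *)
apply: (@filterS _ (nbhs t) _ _ _ _ near_s) => s /= sP Ds; have [->|st] := eqVneq s t.
  by rewrite subrr normr0 ltW.
have := sP st Ds; rewrite sub0r normrN /= mulfVK ?subr_eq0 //.
by rewrite distrC.
Qed.

End DifferenceQuotients.

(** * Edge probabilities and their derivatives *)

Section EdgeProbability.
Variables (R : realType) (V E : finType) (G : mgraph V E).
Implicit Types (e g h : E) (l : R -> E -> R) (P : pred {set E}).

Definition tree_prob (l : E -> R) e :=
  tree_sum G l (fun T => e \in T) / tau G l.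

Lemma curvatureE (l : E -> R) e : src G e != tgt G e -> 0 < l e ->
  curvature G l e = (degree G (src G e))%:R^-1 + (degree G (tgt G e))%:R^-1
    - tree_prob l e.
Proof.
move=> ne le0; rewrite /curvature /eff_resistance tau_contract // /tree_prob.
by rewrite -[l e * _ / _]mulrA [l e * _]mulrC mulfK ?gt_eqF.
Qed.

(** The weight of [T] depends only on the edges outside [T], so [g] contributes through the trees
    avoiding [g], hence the difference. *)
Lemma is_derive_tree_sum l P t (d : E -> R) :
  (forall h, l t h != 0) -> (forall h, is_derive t 1 (l^~ h) (d h)) ->
  is_derive t 1 (fun s => tree_sum G (l s) P)
    (\sum_g d g / l t g *
      (tree_sum G (l t) P - tree_sum G (l t) (fun T => P T && (g \in T)))).
Proof.
move=> l0 ld; apply: is_derive_eq.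
  by apply: is_derive_bigsum => T _; apply: is_derive_bigprod.
under eq_bigr => T _ do rewrite big_distrr /= big_mkcond /=.
rewrite exchange_big /=; apply: eq_bigr => g _.
rewrite [X in _ - X](eq_bigl (fun T => (spanning_tree G T && P T) && (g \in T)));
  last by move=> T; rewrite andbA.
rewrite [X in _ - X]big_mkcondr -sumrB big_distrr /=; apply: eq_bigr => T _.
by case: (g \in T) => /=; rewrite ?subrr ?mulr0 // subr0 mulrC.
Qed.

(** In the quotient rule the products of [tau] with the sum over trees through [e] cancel, leaving
    the covariance of [e] and [g]. The factor is kept as [- d g] because along the flow it is the
    curvature of [g]. *)
Lemma is_derive_tree_prob l e t (d : E -> R) : tau G (l t) != 0 ->
  (forall h, l t h != 0) -> (forall h, is_derive t 1 (l^~ h) (d h)) ->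
  is_derive t 1 (fun s => tree_prob (l s) e)
    (\sum_g (tau G (l t) * tree_sum G (l t) (fun T => (e \in T) && (g \in T))
       - tree_sum G (l t) (fun T => e \in T) * tree_sum G (l t) (fun T => g \in T))
       / tau G (l t) ^+ 2 / l t g * - d g).
Proof.
move=> tau0 l0 ld.
have Nd := is_derive_tree_sum (fun T => e \in T) l0 ld.
have td := is_derive_ext (fun s => esym (tauE G (l s)))
  (is_derive_tree_sum xpredT l0 ld).
have tVd := is_deriveV tau0 td.
apply: (is_derive_eq (is_deriveM Nd tVd)).
rewrite /GRing.scale /= -!tauE !big_distrr -big_split /=; apply: eq_bigr => g _.
by field; rewrite tau0 l0.
Qed.

Lemma cvg_tree_sum l P (F : set_system R) (FF : Filter F) (l1 : E -> R) :
  (forall h, (l^~ h @ F --> l1 h)%classic) ->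
  ((fun s => tree_sum G (l s) P) @ F --> tree_sum G l1 P)%classic.
Proof.
move=> lF; apply: cvg_bigsum => T _.
by apply: cvg_bigprod => h _.
Qed.

Lemma cvg_tree_prob l e (F : set_system R) (FF : Filter F) (l1 : E -> R) :
  tau G l1 != 0 -> (forall h, (l^~ h @ F --> l1 h)%classic) ->
  ((fun s => tree_prob (l s) e) @ F --> tree_prob l1 e)%classic.
Proof.
move=> tau0 lF; apply: cvgM; first exact: cvg_tree_sum.
by apply: cvgV => //; rewrite tauE; under eq_fun do rewrite tauE; apply: cvg_tree_sum.
Qed.

End EdgeProbability.

(** * Invariance of nonnegative curvature along the flow *)

Theorem theorem1p2 (R : realType) (V E : finType) (G : mgraph V E)
  (l0 : E -> R) (T : \bar R) (l : R -> E -> R) :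
  connected_graph G -> loopless G ->
  (forall e, 0 < l0 e) ->
  (0 < T)%E ->
  flow_solution G l0 T l ->
  (forall e, 0 <= curvature G l0 e) ->
  forall (e : E) (t : R), 0 <= t -> (t%:E < T)%E -> 0 <= curvature G (l t) e.
Proof.
(* The tested time [b] is made the right end of a compact interval on which the flow is defined. *)
move=> cG ll l0pos T0 [linit lpos lder] K0 e b b0 bT.
pose D := [set s : R | 0 <= s /\ (s%:E < T)%E]%classic.
have inD s : 0 <= s -> s <= b -> (s%:E < T)%E.
  by move=> _ sb; apply: le_lt_trans bT; rewrite lee_fin.
pose c i : R := (degree G (src G i))%:R^-1 + (degree G (tgt G i))%:R^-1.
pose K i s := c i - tree_prob G (l s) i.
have lpos' s h : 0 <= s -> s <= b -> 0 < l s h by move=> s0 /(inD s s0); apply: lpos.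
have KE i s : 0 <= s -> s <= b -> curvature G (l s) i = K i s.
  by move=> s0 sb; rewrite curvatureE ?lpos'.
have lcont h s : 0 <= s -> s <= b ->
    ((l^~ h) @ within `[0, b] (nbhs s) --> l s h)%classic.
  move=> s0 sb; have := cvg_within_quotient (lder s h s0 (inD s s0 sb)).
  apply: cvg_trans => P /=; rewrite /nbhs /= /within /=.
  apply: filterS => r rP; rewrite in_itv /= => /andP[r0 rb].
  by apply: rP; split=> //; apply: inD.
have lder' h s : s \in `]0, b[ -> is_derive s 1 (l^~ h) (- K h s).
  rewrite in_itv /= => /andP[s0 sb]; rewrite -KE ?ltW //.
  apply: is_derive_within (lder s h (ltW s0) (inD s (ltW s0) (ltW sb))).
  apply: (@nbhs_interval _ _ _ 0%:E b%:E); rewrite ?lte_fin // => r.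
  by rewrite !lte_fin => /ltW r0 /ltW rb; split=> //; apply: inD.
(* By compactness each resistance has a positive minimum on [[0, b]]; the sum of the reciprocal
   minima bounds all the reciprocals at once. *)
have [M M0 lM] : exists2 M : R, 0 <= M &
    forall h s, 0 <= s -> s <= b -> (l s h)^-1 <= M.
  have /(_ _)/cid2 mP h : exists2 m, 0 < m & forall s, 0 <= s -> s <= b -> m <= l s h.
    have [|r] := @EVT_min R (l^~ h) 0 b b0.
      apply/subspace_continuousP => s /=; rewrite in_itv /= => /andP[].
      exact: lcont.
    rewrite in_itv /= => /andP[r0 rb] rmin; exists (l r h); first exact: lpos'.
    by move=> s s0 sb; apply: rmin; rewrite in_itv /= s0.
  pose m h := s2val (mP h).
  have m0 h : 0 < m h := s2valP (mP h).
  exists (\sum_h (m h)^-1) => [|h s s0 sb].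
    by apply: sumr_ge0 => h _; rewrite invr_ge0 ltW.
  rewrite (bigD1 h) //= ler_wpDr //.
    by apply: sumr_ge0 => k _; rewrite invr_ge0 ltW.
  by rewrite lef_pV2 ?posrE ?lpos' //; apply: (s2valP' (mP h)).
rewrite KE //.
(* Minus the covariance of [i] and [j], over [l s j]: the sign is reversed because the probability
   enters [K] negatively. *)
pose A i j s := (tree_sum G (l s) (fun F => i \in F) * tree_sum G (l s) (fun F => j \in F)
  - tau G (l s) * tree_sum G (l s) (fun F => (i \in F) && (j \in F)))
  / tau G (l s) ^+ 2 / l s j.
have taupos s : 0 <= s -> s <= b -> 0 < tau G (l s).
  by move=> s0 sb; apply: tau_gt0 => // h; apply: lpos'.
apply: (@metzler_invariance R E b M K A) => // [i|i s|i j s|i j s|i].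
- apply/subspace_continuousP => s /=; rewrite in_itv /= => /andP[s0 sb].
  apply: cvgB; first exact: cvg_cst.
  apply: cvg_tree_prob; first by rewrite gt_eqF ?taupos.
  by move=> h; apply: lcont.
- move=> sb; have := sb; rewrite in_itv /= => /andP[/ltW s0 /ltW sb'].
  have := is_derive_tree_prob i (lt0r_neq0 (taupos s s0 sb'))
    (fun h => lt0r_neq0 (lpos' s h s0 sb')) (fun h => lder' h s sb).
  move=> pd; apply: (is_derive_eq (is_deriveB (is_derive_cst (c i) s 1) pd)).
  rewrite sub0r -sumrN; apply: eq_bigr => j _; rewrite /A.
  by rewrite opprK -mulNr -mulNr -mulNr opprB.
- rewrite in_itv /= => /andP[/ltW s0 /ltW sb] ij; rewrite /A.
  rewrite !divr_ge0 ?sqr_ge0 //; last exact/ltW/lpos'.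
  by rewrite subr_ge0 negative_correlation // => h; apply: lpos'.
- rewrite in_itv /= => /andP[/ltW s0 /ltW sb]; rewrite /A.
  have lp h : 0 < l s h by apply: lpos'.
  rewrite normrM -[leRHS]mul1r ler_pM // ?normr_ge0 //; last first.
    by rewrite ger0_norm ?invr_ge0 ?lM // ltW.
  have tp := taupos s s0 sb.
  rewrite normrM normfV [X in _ / X]ger0_norm ?sqr_ge0 // ler_pdivrMr ?exprn_gt0 // mul1r.
  (* All tree sums lie between 0 and [tau], so the covariance has absolute value at most 1 and only
     the factor bounded by [M] remains. *)
  have le1 P : 0 <= tree_sum G (l s) P <= tau G (l s).
    by rewrite tree_sum_ge0 //= tauE tree_sum_le.
  have /andP[] := le1 (fun F => i \in F); have /andP[] := le1 (fun F => j \in F).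
  have /andP[] := le1 (fun F => (i \in F) && (j \in F)).
  rewrite ler_norml.
  move: (tree_sum _ _ _) (tree_sum _ _ _) (tree_sum _ _ _) (tau _ _) tp => x y z u up.
  by move=> *; apply/andP; split; nra.
- by rewrite -KE // (_ : l 0 = l0) //; apply/funext => h; apply: linit.
Qed.
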